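(* Let $N\geq 3$. Then there exist $t_0>0$ and positive constants $C_{1,N}$, $C_{2,N}$ depending only on $N$ such that, for all $t\geq t_0$, \[ C_{1,N}\,t^{-\frac{N}{2}}\leq\int_{\mathbb{R}^N} (1 + |\xi|^2)^{-t}\sin^2\Big(t\sqrt{\log(1 + |\xi|^2)}\Big)\,d\xi\leq C_{2,N}\,t^{-\frac{N}{2}}. \]
   Context: Here $\log$ is the natural logarithm and $|\xi|$ is the Euclidean norm of $\xi\in\mathbb{R}^N$. *)

(* Defs.v *)
From HB Require Import structures.
From mathcomp Require Import all_boot all_order all_algebra.
From mathcomp Require Import all_classical all_reals all_analysis.

Set Implicit Arguments.
Unset Strict Implicit.
Unset Printing Implicit Defensive.
Import Order.TTheory GRing.Theory Num.Theory.
Import numFieldNormedType.Exports.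

Local Open Scope classical_set_scope.
Local Open Scope ring_scope.

Definition consp (T : Type) (n : nat) (p : T * n.-tuple T) : n.+1.-tuple T :=
  [tuple of p.1 :: p.2].

(* R^n is n.-tuple (measurableTypeR R), where measurableTypeR R is R equipped
   with its Borel sets; its Lebesgue measure is the n-fold product of
   lebesgue_measure, transported along R * R^n ~ R^(n+1) (R^0 is a point of
   mass 1). *)
Fixpoint lebesgue_measure_tuple (R : realType) (n : nat) :
    set (n.-tuple (measurableTypeR R)) -> \bar R :=
  match n with
  | 0 => \d_[tuple]
  | m.+1 => pushforward (lebesgue_measure \x @lebesgue_measure_tuple R m)%E
                        (@consp (measurableTypeR R) m)
  end.
Arguments lebesgue_measure_tuple {R} n _.

Section lebesgue_measure_tuple_theory.
Variable R : realType.
Local Notation T := (measurableTypeR R).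
Local Notation leb := (@lebesgue_measure_tuple R).

Lemma measurable_consp (n : nat) : measurable_fun setT (@consp T n).
Proof. exact: measurable_cons. Qed.

Definition unconsp (n : nat) (x : n.+1.-tuple T) : T * n.-tuple T :=
  (thead x, [tuple of behead x]).

Lemma measurable_unconsp (n : nat) : measurable_fun setT (@unconsp n).
Proof.
apply/measurable_fun_pair => /=; first exact: measurable_tnth.
exact: measurable_behead.
Qed.

Lemma conspK (n : nat) : cancel (@consp T n) (@unconsp n).
Proof.
move=> [x y]; rewrite /unconsp /consp /= theadE; congr (_, _).
exact/val_inj.
Qed.

Lemma unconspK (n : nat) : cancel (@unconsp n) (@consp T n).
Proof. by move=> x; rewrite /consp /unconsp /= [RHS]tuple_eta. Qed.

Lemma lebesgue_measure_tuple_sigma_finite_measure (n : nat) :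
  {mu : {sigma_finite_measure set (n.-tuple T) -> \bar R} |
    leb n = mu :> (set _ -> \bar R)}.
Proof.
elim: n => [|n [mu muE]].
  by exists (\d_[tuple] : {finite_measure set (0.-tuple T) -> \bar R}).
pose nu : {measure set (T * n.-tuple T)%type -> \bar R} :=
  (@lebesgue_measure R \x mu)%E.
have lebE : leb n.+1 = pushforward nu (@consp T n) by rewrite /= muE.
have pf0 : leb n.+1 set0 = 0%E by rewrite lebE /pushforward preimage_set0 measure0.
have pf_ge0 A : (0 <= leb n.+1 A)%E by rewrite lebE /pushforward measure_ge0.
have pf_sigma : semi_sigma_additive (leb n.+1).
  rewrite lebE => F mF tF mUF; rewrite /pushforward preimage_bigcup.
  apply: measure_semi_sigma_additive.
  - by move=> k; rewrite -[X in measurable X]setTI; exact: measurable_consp.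
  - apply/trivIsetP => /= i j _ _ ij; rewrite -preimage_setI.
    by move/trivIsetP : tF => /(_ _ _ _ _ ij) ->//; rewrite preimage_set0.
  - by rewrite -preimage_bigcup -[X in measurable X]setTI; exact: measurable_consp.
have pf_sigma_finite : sigma_finite setT (leb n.+1).
  have /sigma_finiteP[F [FT ndF Ffin]] := sigma_finiteT (@lebesgue_measure R).
  have /sigma_finiteP[G [GT ndG Gfin]] := sigma_finiteT mu.
  rewrite lebE; exists (fun k => @unconsp n @^-1` (F k `*` G k)).
    apply/seteqP; split => // x _; have [[i _ Fi] [j _ Gj]] :
        (\bigcup_k F k) (unconsp x).1 /\ (\bigcup_k G k) (unconsp x).2.
      by rewrite -FT -GT.
    exists (maxn i j) => //; split => /=.
    - by move: Fi; exact/subsetPset/ndF/leq_maxl.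
    - by move: Gj; exact/subsetPset/ndG/leq_maxr.
  move=> k; have [mF Fk] := Ffin k; have [mG Gk] := Gfin k; split.
    rewrite -[X in measurable X]setTI; apply: measurable_unconsp => //.
    exact: measurableX.
  rewrite /pushforward -comp_preimage.
  rewrite (_ : _ \o _ = id); last by apply/funext => p /=; rewrite conspK.
  by rewrite preimage_id /nu/= product_measure1E// lte_mul_pinfty// ge0_fin_numE.
pose m1 := @isMeasure.Build _ _ _ (leb n.+1) pf0 pf_ge0 pf_sigma.
pose mm : {measure set (n.+1.-tuple T) -> \bar R} := HB.pack (leb n.+1) m1.
pose m2 := @Measure_isSigmaFinite.Build _ _ _ mm pf_sigma_finite.
pose ms : {sigma_finite_measure set (n.+1.-tuple T) -> \bar R} :=
  HB.pack (leb n.+1) m1 m2.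
by exists ms.
Qed.

Section instances.
Variable n : nat.

Let leb0 : leb n set0 = 0%E.
Proof.
by have [mu ->] := lebesgue_measure_tuple_sigma_finite_measure n; rewrite measure0.
Qed.

Let leb_ge0 A : (0 <= leb n A)%E.
Proof.
by have [mu ->] := lebesgue_measure_tuple_sigma_finite_measure n; rewrite measure_ge0.
Qed.

Let leb_sigma_additive : semi_sigma_additive (leb n).
Proof.
have [mu ->] := lebesgue_measure_tuple_sigma_finite_measure n.
exact: measure_semi_sigma_additive.
Qed.

HB.instance Definition _ := isMeasure.Build _ _ _ (leb n)
  leb0 leb_ge0 leb_sigma_additive.

Let leb_sigma_finite : sigma_finite setT (leb n).
Proof.
have [mu ->] := lebesgue_measure_tuple_sigma_finite_measure n.
exact: sigma_finiteT.
Qed.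

HB.instance Definition _ := @Measure_isSigmaFinite.Build _ _ _ (leb n)
  leb_sigma_finite.

End instances.

Lemma lebesgue_measure_tuple_box (n : nat) (A : 'I_n -> set T) :
  (forall i, measurable (A i)) ->
  leb n [set x | forall i, A i (tnth x i)] =
    (\prod_(i < n) lebesgue_measure (A i))%E.
Proof.
elim: n A => [|n IHn] A mA.
  rewrite big_ord0 /= diracE mem_set//= => -[]//.
rewrite big_ord_recl -IHn//= /pushforward -product_measure1E//.
  congr (_ _); apply/seteqP; split => [[x y]|[x y] [/= A0 AS] i] /=.
    move=> Axy; split; first by have := Axy ord0; rewrite tnth0.
    by move=> i; have := Axy (lift ord0 i); rewrite tnthS; congr (A _ _);
      rewrite !(tnth_nth x).
  case: (unliftP ord0 i) => [j ->|->]; last by rewrite tnth0.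
  by rewrite tnthS; have := AS j; congr (A _ _); rewrite !(tnth_nth x).
rewrite (_ : [set x | _] = \bigcap_(i in [set: 'I_n])
    ((fun x : n.-tuple T => tnth x i) @^-1` A (lift ord0 i))); last first.
  by apply/seteqP; split => [x Ax i _|x Ax i]; [exact: Ax|exact: (Ax i)].
apply: fin_bigcap_measurable => // i _.
by rewrite -[X in measurable X]setTI; exact: measurable_tnth.
Qed.

End lebesgue_measure_tuple_theory.

Definition euclidean_norm (R : realType) (n : nat) (x : n.-tuple (measurableTypeR R)) : R :=
  Num.sqrt (\sum_(i < n) (tnth x i : R) ^+ 2).

(* Main.v *)
Require Import Defs.
From mathcomp Require Import all_boot all_order all_algebra.
From mathcomp Require Import all_classical all_reals all_analysis.
From mathcomp Require Import measurable_realfun ring lra.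
Import Order.TTheory GRing.Theory Num.Theory.
Import numFieldNormedType.Exports.
Local Open Scope classical_set_scope.
Local Open Scope ring_scope.

(* Upper bound: sin^2 <= 1, and by Bernoulli's inequality (1 + |x|^2)^t is at
   least the product over i of 1 + (t/N) x_i^2, so that the integral is bounded
   by a product of N arctangent integrals.
   Lower bound: put h = t^(-1/2) and restrict to the box [h, 2h]^N, where
   (1 + |x|^2)^(-t) >= e^(-4N). With all coordinates but the first frozen, the
   phase phi = t sqrt(log(1 + |x|^2)) satisfies phi' <= 2t, so the integral of
   sin^2 phi over [h, 2h] is at least 1/(2t) times that of (sin^2 phi) phi',
   which is explicit; as phi grows by at least a multiple of 1/h on [h, 2h],
   this is at least a multiple of h. *)

(** * Elementary inequalities for logarithms and real powers *)

Lemma ln1D_ge (R : realType) (u : R) : 0 <= u -> u / (1 + u) <= ln (1 + u).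
Proof.
move=> u0; have u1 : 0 < 1 + u by lra.
(* The bound [ln z <= z - 1] is taken at [z = (1 + u)^-1], which turns an upper bound into a lower
   one. *)
have /le_ln1Dx : -1 < (1 + u)^-1 - 1 by rewrite ltrBrDr addNr invr_gt0.
rewrite addrC subrK lnV ?posrE//.
have -> : u / (1 + u) = 1 - (1 + u)^-1 by field; rewrite gt_eqF.
lra.
Qed.

(** After taking logarithms, [ln z <= z - 1] at [z = (1 + s * y) / (1 + y)] gives
    [ln z <= (s - 1) * (y / (1 + y))], and [ln1D_ge] bounds this by [(s - 1) * ln (1 + y)]. *)
Lemma bernoulli_powR (R : realType) (y s : R) :
  0 <= y -> 1 <= s -> 1 + s * y <= (1 + y) `^ s.
Proof.
move=> y0 s1; have c0 : 0 < 1 + y by lra.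
have sy0 : 0 < 1 + s * y by nra.
rewrite /powR gt_eqF// -[leLHS]lnK ?posrE// ler_expR.
have /le_ln1Dx : -1 < (1 + s * y) / (1 + y) - 1.
  by rewrite ltrBrDr addNr divr_gt0.
rewrite addrC subrK ln_div ?posrE//.
have -> : (1 + s * y) / (1 + y) - 1 = (s - 1) * (y / (1 + y)).
  by field; rewrite gt_eqF.
have := ln1D_ge _ _ y0; nra.
Qed.

(** * Integration over tuples, one coordinate at a time *)

Lemma ge0_integral_lebesgue_measure_tupleS (R : realType) (n : nat)
    (f : n.+1.-tuple (measurableTypeR R) -> \bar R) :
  measurable_fun setT f -> (forall x, 0 <= f x)%E ->
  (\int[lebesgue_measure_tuple n.+1]_(x in [set: n.+1.-tuple (measurableTypeR R)])
      f x =
   \int[lebesgue_measure_tuple n]_(y in [set: n.-tuple (measurableTypeR R)])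
      \int[lebesgue_measure]_x f (consp (x, y)))%E.
Proof.
move=> mf f0.
have mcf := measurableT_comp mf (@measurable_consp R n).
(* Change of variables along [consp], then Tonelli. The head coordinate is integrated innermost: it
   is the one that varies in the lower bound while the others are frozen. *)
transitivity (\int[(lebesgue_measure \x lebesgue_measure_tuple n)]_z
    (f \o @consp (measurableTypeR R) n) z)%E.
  rewrite -(@ge0_integral_pushforward _ _ _ _ _ _ (@measurable_consp R n)
    (lebesgue_measure \x lebesgue_measure_tuple n)%E setT)//.
rewrite (@fubini_tonelli2 _ _ _ _ R lebesgue_measure (lebesgue_measure_tuple n)
  (f \o @consp _ n))//.
by move=> x; exact: f0.
Qed.

Lemma tnth_consp0 (T : Type) (n : nat) (p : T * n.-tuple T) :
  tnth (consp p) ord0 = p.1.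
Proof. by rewrite tnth0. Qed.

Lemma tnth_conspS (T : Type) (n : nat) (p : T * n.-tuple T) (i : 'I_n) :
  tnth (consp p) (lift ord0 i) = tnth p.2 i.
Proof. by rewrite tnthS !(tnth_nth p.1). Qed.

Lemma ge0_integral_prod_tuple (R : realType) (n : nat) (g : R -> R) (c : R) :
  measurable_fun setT g -> (forall x, 0 <= g x) ->
  (\int[lebesgue_measure]_x (g x)%:E = c%:E)%E ->
  (\int[lebesgue_measure_tuple n]_(x in [set: n.-tuple (measurableTypeR R)])
      (\prod_(i < n) g (tnth x i))%:E =
   (c ^+ n)%:E)%E.
Proof.
move=> mg g0 intg; elim: n => [|n IHn].
  under eq_integral do rewrite big_ord0.
  by rewrite integral_cst//= diracE mem_set//= mule1 expr0.
have mprod m : measurable_fun setT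
    (fun x : m.-tuple (measurableTypeR R) => (\prod_(i < m) g (tnth x i))%:E).
  apply/measurable_EFinP; apply: measurable_prod => i _.
  by apply: measurableT_comp => //; exact: measurable_tnth.
have prod0 m (x : m.-tuple (measurableTypeR R)) : 0 <= \prod_(i < m) g (tnth x i).
  by apply: prodr_ge0.
rewrite ge0_integral_lebesgue_measure_tupleS//=; last first.
  by move=> x; rewrite lee_fin; exact: prod0.
transitivity (\int[lebesgue_measure_tuple n]_(y in [set: n.-tuple (measurableTypeR R)])
    (c%:E * (\prod_(i < n) g (tnth y i))%:E))%E.
  apply: eq_integral => y _.
  under eq_integral => x _.
    rewrite big_ord_recl tnth_consp0 /= EFinM.
    under eq_bigr do rewrite tnth_conspS.
    over.
  rewrite /= ge0_integralZr ?intg ?lee_fin//.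
  - exact/measurable_EFinP.
  - by move=> x _; rewrite lee_fin.
  - exact: prod0.
have := @ge0_integralZl _ _ _ (lebesgue_measure_tuple n) setT measurableT _
  (mprod n) c%:E.
rewrite IHn exprS => ->//.
  by move=> x _; rewrite lee_fin; exact: prod0.
(* [c] is nonnegative because it is the integral of [g]. *)
by rewrite -intg integral_ge0// => x _; rewrite lee_fin.
Qed.

(** The integrand is even, so the integral is twice that over the half-line, where the
    antiderivative [atan (b * x) / b] rises from 0 to [pi / 2 / b]. *)
Lemma integral_oneDsqrM (R : realType) (b : R) : 0 < b ->
  (\int[lebesgue_measure]_x (1 + (b * x) ^+ 2)^-1%:E = (pi / b)%:E)%E.
Proof.
move=> b0.
have cf : continuous (fun x : R => (1 + (b * x) ^+ 2)^-1).
  move=> x; apply: (@continuous_comp _ _ _ ( *%R b) (fun y => (1 + y ^+ 2)^-1)).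
    exact: mulrl_continuous.
  exact: continuous_oneDsqrV.
have f0 x : 0 <= (1 + (b * x) ^+ 2)^-1 :> R by rewrite invr_ge0 addr_ge0// sqr_ge0.
have dF (x : R) : is_derive x 1 (fun x => atan (b * x) / b) (1 + (b * x) ^+ 2)^-1.
  have ? := is_derive1_comp (is_derive1_atan (b * x)) (is_deriveZ b (is_derive_id x 1)).
  apply: is_derive_eq.
  rewrite scaler0 add0r -[b *: 1]/(b * 1) -[LHS]/(_ * _) mulr1 mulrCA.
  by rewrite mulVf ?mulr1// gt_eqF.
have fN : (fun x : R => (1 + (b * x) ^+ 2)^-1) =1
    (fun x : R => (1 + (b * x) ^+ 2)^-1) \o -%R.
  by move=> y /=; rewrite mulrN sqrrN.
apply: etrans (ge0_symfun_integralT f0 cf fN) _.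
rewrite -set_itvcy (@ge0_continuous_FTC2y _ _ (fun x => atan (b * x) / b) 0 (pi / 2 / b))//.
- rewrite mulr0 atan0 mul0r sube0 -EFinM; congr EFin.
  by field; rewrite gt_eqF.
- by apply: continuous_subspaceT.
- have bxy : b * x @[x --> +oo] --> +oo.
    by apply: gt0_cvgMry => //; exact: cvg_id.
  have atanbx : atan (b * x) @[x --> +oo] --> pi / 2.
    exact: (cvg_comp _ _ bxy (@cvgy_atan R)).
  exact: cvgMr_tmp.
- apply: cvg_at_right_filter.
  by have /(@ex_derive _ _ _ _ _ _ _)/derivable1_diffP/differentiable_continuous := dF 0.
- by move=> x _; rewrite derive1E derive_val.
Qed.

(** * Lower bounds for oscillating integrals in one variable *)

(** Since [dphi <= M], the integral times [M] is at least that of [sin (phi x) ^+ 2 * dphi x], whose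
    antiderivative is [F] below. As [sin * cos] lies between -1/2 and 1/2, the oscillating part of
    [F] costs at most 1/2. *)
Lemma ge_integral_sin2 (R : realType) (phi dphi : R -> R) (a b M : R) :
  a < b -> 0 < M ->
  (forall x, a <= x <= b -> is_derive x 1 phi (dphi x)) ->
  {within `[a, b], continuous dphi} ->
  (forall x, a <= x <= b -> dphi x <= M) ->
  (((phi b - phi a - 1) / (2 * M))%:E <=
   \int[lebesgue_measure]_(x in `[a, b]) (sin (phi x) ^+ 2)%:E)%E.
Proof.
move=> ab M0 dphiP cdphi dphiM.
pose F x := (phi x - sin (phi x) * cos (phi x)) / 2.
have dF x : a <= x <= b -> is_derive x 1 F (sin (phi x) ^+ 2 * dphi x).
  move=> /dphiP dx.
  have ds := is_derive1_comp (is_derive_sin (phi x)) dx.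
  have dc := is_derive1_comp (is_derive_cos (phi x)) dx.
  have := is_deriveM (is_deriveB dx (is_deriveM ds dc)) (is_derive_cst (2^-1 : R) x 1).
  move=> /is_derive_eq; apply.
  rewrite /= scaler0 add0r /GRing.scale/=.
  have /eqP := cos2Dsin2 (phi x); rewrite eq_sym -subr_eq => /eqP/esym.
  set s := sin _; set c := cos _ => sE.
  transitivity ((1 - c ^+ 2 + s ^+ 2) / 2 * dphi x); first by field.
  by rewrite sE; field.
have cphi : {within `[a, b], continuous phi}.
  apply: derivable_within_continuous => x; rewrite in_itv/= => /dphiP dx.
  exact: ex_derive.
have csin2 : {within `[a, b], continuous (fun x => sin (phi x) ^+ 2)}.
  have cs (y : R) : {for y, continuous (fun y => sin y ^+ 2)}.
    exact: (cvgM (@continuous_sin R y) (@continuous_sin R y)).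
  move=> x; exact: (@continuous_comp (subspace `[a, b]) R R phi (fun y => sin y ^+ 2)
    x (cphi x) (cs _)).
have cf : {within `[a, b], continuous (fun x => sin (phi x) ^+ 2 * dphi x)}.
  by move=> x; apply: cvgM; [exact: csin2|exact: cdphi].
have cF x : a <= x <= b -> F y @[y --> x] --> F x.
  move=> /dF dx; apply/differentiable_continuous/derivable1_diffP.
  exact: ex_derive.
have intE : (\int[lebesgue_measure]_(x in `[a, b]) (sin (phi x) ^+ 2 * dphi x)%:E
    = (F b)%:E - (F a)%:E)%E.
  apply: continuous_FTC2 => //.
    split.
    - move=> x /[!in_itv]/= /andP[/ltW ax /ltW xb].
      by have := dF x; rewrite ax xb => /(_ isT) dx; exact: ex_derive.
    - by apply: cvg_at_right_filter; apply: cF; rewrite lexx ltW.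
    - by apply: cvg_at_left_filter; apply: cF; rewrite lexx ltW.
  move=> x /[!in_itv]/= /andP[/ltW ax /ltW xb].
  have := dF x; rewrite ax xb => /(_ isT) dx.
  by rewrite derive1E derive_val.
have Fab : (phi b - phi a - 1) / 2 <= F b - F a.
  (* Expanding the squares of [sin y + cos y] and [sin y - cos y], both nonnegative, gives the two
     sides. *)
  have h y : `|sin y * cos y| <= 2^-1 :> R.
    have := cos2Dsin2 y; have := sqr_ge0 (sin y - cos y).
    have := sqr_ge0 (sin y + cos y).
    rewrite ler_norml; nra.
  have := h (phi a); have := h (phi b); rewrite !ler_norml /F.
  lra.
have ims : measurable_fun `[a, b] (fun x => (sin (phi x) ^+ 2)%:E).
  by apply/measurable_EFinP; exact: subspace_continuous_measurable_fun.
have : (((phi b - phi a - 1) / 2)%:E <=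
   M%:E * \int[lebesgue_measure]_(x in `[a, b]) (sin (phi x) ^+ 2)%:E)%E.
  rewrite -ge0_integralZl//; last first.
  - by rewrite lee_fin ltW.
  - by move=> x _; rewrite lee_fin sqr_ge0.
  apply: (@le_trans _ _ ((F b)%:E - (F a)%:E)%E); first by rewrite -EFinB lee_fin.
  rewrite -intE; apply: le_integral => //=.
  - exact: continuous_compact_integrable (@segment_compact _ _ _) cf.
  - apply: (@continuous_compact_integrable _ (fun x => M * sin (phi x) ^+ 2)).
      exact: segment_compact.
    by move=> x; apply: cvgM; [exact: cvg_cst|exact: csin2].
  - move=> x /set_mem/= /[!in_itv]/= xab.
    rewrite -EFinM lee_fin mulrC ler_wpM2r ?sqr_ge0//; exact: dphiM.
rewrite -lee_pdivrMl// -EFinM; congr (_%:E <= _)%E.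
by field; rewrite gt_eqF.
Qed.

(* [K] plays the dimension, [h] is [t ^ (-1/2)], and [q] is the sum of the squares
   of the frozen coordinates. *)
Lemma ge_integral_sin2_sqrt_ln (R : realType) (h q K : R) :
  0 < h -> 1 <= K -> 8 * K * h <= 1 -> 0 <= q ->
  4 * h ^+ 2 + q <= 4 * K * h ^+ 2 ->
  ((h / (32 * K))%:E <= \int[lebesgue_measure]_(x in `[h, (2 * h)%R])
    (sin ((h ^+ 2)^-1 * Num.sqrt (ln (1 + (x ^+ 2 + q)))) ^+ 2)%:E)%E.
Proof.
move=> h0 K1 Kh q0 qK.
have K0 : 0 < K by lra.
have h2 : 0 < h ^+ 2 by rewrite exprn_gt0.
(* This keeps [u x <= 1] on the interval, so [1 + u x <= 2] and [ln (1 + u x)] is comparable to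
   [u x]. *)
have small : 4 * K * h ^+ 2 <= 1.
  have : (8 * K * h) ^+ 2 <= 1 by rewrite expr_le1// mulr_ge0// ?mulr_ge0// ltW.
  nra.
pose u x := x ^+ 2 + q.
have uP x : h <= x <= 2 * h ->
    h ^+ 2 <= x ^+ 2 <= 4 * h ^+ 2 /\ 0 < u x <= 4 * K * h ^+ 2.
  move=> /andP[hx xh]; rewrite /u.
  have xx : h ^+ 2 <= x ^+ 2 <= 4 * h ^+ 2.
    by apply/andP; split; nra.
  by split => //; case/andP: xx => ? ?; apply/andP; split; lra.
have LP x : h <= x <= 2 * h -> u x / 2 <= ln (1 + u x) <= u x.
  move=> /uP[_ /andP[u0 u1]]; apply/andP; split; last by apply: le_ln1Dx; lra.
  apply: le_trans (ln1D_ge _ _ (ltW u0)).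
  by rewrite ler_wpM2l ?lef_pV2 ?posrE; lra.
pose sL x := Num.sqrt (ln (1 + u x)).
(* Square roots of [(x / 2) ^+ 2 <= u x / 2] and of [u x <= 4 * K * h ^+ 2 <= (2 * K * h) ^+ 2]; the
   last inequality uses [1 <= K]. *)
have sLP x : h <= x <= 2 * h -> [/\ 0 < sL x, x / 2 <= sL x & sL x <= 2 * K * h].
  move=> xh; have /andP[L1 L2] := LP _ xh; have [/andP[x1 x2] /andP[u0 u1]] := uP _ xh.
  have x0 : 0 < x by case/andP: xh => ? _; exact: lt_le_trans h0 _.
  split.
  - by rewrite sqrtr_gt0; lra.
  - have x20 : 0 <= x / 2 by lra.
    rewrite -(ger0_norm x20) -sqrtr_sqr /sL ler_wsqrtr//.
    by apply: le_trans L1; rewrite expr_div_n /u; lra.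
  - have Kh0 : 0 <= 2 * K * h by rewrite !mulr_ge0// ltW.
    rewrite -(ger0_norm Kh0) -sqrtr_sqr /sL ler_wsqrtr//.
    apply: (le_trans L2); apply: (le_trans u1).
    have : K * h ^+ 2 <= K ^+ 2 * h ^+ 2 by rewrite ler_wpM2r ?(ltW h2)//; nra.
    by rewrite !exprMn; lra.
pose phi x := (h ^+ 2)^-1 * sL x.
pose dphi x := (h ^+ 2)^-1 * ((2 * sL x)^-1 * ((1 + u x)^-1 * (2 * x))).
have hh : h < 2 * h by lra.
have M0 : 0 < 2 / h ^+ 2 by rewrite divr_gt0.
have dphiP x : h <= x <= 2 * h -> is_derive x 1 phi (dphi x).
  move=> xh; have [_ /andP[u0 _]] := uP _ xh; have /andP[L1 _] := LP _ xh.
  have L0 : 0 < ln (1 + u x) by lra.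
  have du : is_derive x 1 (fun x => 1 + u x) (2 * x).
    by apply: is_derive_eq; rewrite /GRing.scale/=; ring.
  have u10 : 0 < 1 + u x by lra.
  have d1 := @is_derive1_comp _ (@ln R) (fun x => 1 + u x) _ _ _
    (is_derive1_ln u10) du.
  have d2 := @is_derive1_comp _ Num.sqrt (fun x => ln (1 + u x)) _ _ _
    (is_derive1_sqrt L0) d1.
  exact: is_deriveZ d2.
have cdphi : {within `[h, 2 * h], continuous dphi}.
  apply: continuous_in_subspaceT => x /set_mem/= /[!in_itv]/= xh.
  have [_ /andP[u0 _]] := uP _ xh; have [sL0 _ _] := sLP _ xh.
  have cu : {for x, continuous (fun x => 1 + u x)}.
    apply: cvgD; first exact: cvg_cst.
    by apply: cvgD; [exact: exprn_continuous|exact: cvg_cst].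
  have u10 : 0 < 1 + u x by lra.
  have csL : {for x, continuous sL}.
    exact: continuous_comp (continuous_comp cu (continuous_ln u10)) (@sqrt_continuous R _).
  apply: cvgM; first exact: cvg_cst.
  apply: cvgM.
    apply: cvgV; first by rewrite gt_eqF// mulr_gt0.
    by apply: cvgM => //; exact: cvg_cst.
  apply: cvgM; first by apply: cvgV => //; rewrite gt_eqF.
  by apply: cvgM; [exact: cvg_cst|exact: cvg_id].
(* Here [dphi x] is [x / (sL x * (1 + u x))] divided by [h ^+ 2], and [x / 2 <= sL x] bounds the
   quotient by 2. *)
have dphiM x : h <= x <= 2 * h -> dphi x <= 2 / h ^+ 2.
  move=> xh; have [_ /andP[u0 _]] := uP _ xh; have [sL0 xsL _] := sLP _ xh.
  rewrite /dphi mulrC ler_pM2r ?invr_gt0//.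
  have u10 : 0 < 1 + u x by lra.
  rewrite mulrC ler_pdivrMr ?mulr_gt0// mulrC ler_pdivrMr//.
  have : sL x <= sL x * (1 + u x) by rewrite ler_peMr ?ltW//; lra.
  lra.
apply: le_trans (ge_integral_sin2 _ _ _ _ _ _ hh M0 dphiP cdphi dphiM).
rewrite lee_fin.
have P1 : h <= h <= 2 * h by rewrite lexx ltW.
have P2 : h <= 2 * h <= 2 * h by rewrite lexx ltW.
have [_ /andP[u10 u1K]] := uP _ P1; have [_ /andP[u20 u2K]] := uP _ P2.
(* [u] grows by [3 * h ^+ 2] from [h] to [2 * h], and the derivative of the logarithm is at least
   1/2 there; [ln z <= z - 1] at the ratio of the endpoint values makes this precise. *)
have lnB : 3 / 2 * h ^+ 2 <= ln (1 + u (2 * h)) - ln (1 + u h).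
  have v1 : 0 < 1 + u h by lra.
  have v2 : 0 < 1 + u (2 * h) by lra.
  have /le_ln1Dx : -1 < (1 + u h) / (1 + u (2 * h)) - 1.
    by rewrite ltrBrDr addNr divr_gt0.
  rewrite addrC subrK ln_div ?posrE//.
  suff : (1 + u h) / (1 + u (2 * h)) - 1 <= - (3 / 2 * h ^+ 2) by lra.
  rewrite lerBlDr ler_pdivrMr//.
  have uE : u (2 * h) = u h + 3 * h ^+ 2 by rewrite /u; ring.
  have : h ^+ 2 * (1 + u (2 * h)) <= h ^+ 2 * 2 by rewrite ler_pM2l//; lra.
  lra.
have [s10 _ s1K] := sLP _ P1; have [s20 _ s2K] := sLP _ P2.
(* A difference of square roots is the difference of the radicands over the sum of the roots, and
   that sum is at most [4 * K * h]. *)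
have sLB : 3 / (8 * K) * h <= sL (2 * h) - sL h.
  have Kh0 : 0 < 4 * K * h by rewrite !mulr_gt0.
  have /andP[L1 _] := LP _ P1; have /andP[L2 _] := LP _ P2.
  have E : (sL (2 * h) - sL h) * (sL (2 * h) + sL h) = ln (1 + u (2 * h)) - ln (1 + u h).
    by rewrite -subr_sqr !sqr_sqrtr//; lra.
  have S0 : 0 < sL (2 * h) + sL h by rewrite addr_gt0.
  have D0 : 0 < sL (2 * h) - sL h.
    by rewrite -(pmulr_lgt0 _ S0) E; lra.
  rewrite -(ler_pM2r Kh0) (_ : _ * _ * (4 * K * h) = 3 / 2 * h ^+ 2); last first.
    by field; rewrite gt_eqF.
  apply: (le_trans lnB); rewrite -E ler_pM2l//; lra.
(* With [Y = (8 * K * h)^-1], the phase grows by at least [3 * Y]. As [1 <= Y], the loss of 1 in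
   [ge_integral_sin2] is absorbed and more than the required [Y] remains. *)
have Y1 : 1 <= (8 * K * h)^-1 by rewrite invf_ge1// !mulr_gt0.
have phiB : 3 * (8 * K * h)^-1 <= phi (2 * h) - phi h.
  rewrite /phi -mulrBr ler_pdivlMl//; apply: le_trans sLB.
  rewrite le_eqVlt; apply/orP; left; apply/eqP; field.
  by rewrite !gt_eqF.
rewrite ler_pdivlMr ?mulr_gt0 ?invr_gt0//.
rewrite (_ : h / (32 * K) * (2 * (2 / h ^+ 2)) = (8 * K * h)^-1); last first.
  by field; rewrite !gt_eqF.
by lra.
Qed.

(** * The Euclidean norm and the integrand *)

Lemma sqr_euclidean_norm (R : realType) (n : nat) (x : n.-tuple (measurableTypeR R)) :
  euclidean_norm x ^+ 2 = \sum_(i < n) (tnth x i : R) ^+ 2.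
Proof. by rewrite sqr_sqrtr// sumr_ge0// => i _; exact: sqr_ge0. Qed.

Lemma sqr_euclidean_norm_consp (R : realType) (n : nat)
    (p : measurableTypeR R * n.-tuple (measurableTypeR R)) :
  euclidean_norm (consp p) ^+ 2 = (p.1 : R) ^+ 2 + euclidean_norm p.2 ^+ 2.
Proof.
rewrite !sqr_euclidean_norm big_ord_recl tnth_consp0; congr (_ + _).
by apply: eq_bigr => i _; rewrite tnth_conspS.
Qed.

Lemma measurable_euclidean_norm (R : realType) (n : nat) :
  measurable_fun setT (@euclidean_norm R n).
Proof.
apply: measurableT_comp; first exact: (continuous_measurable_fun (@sqrt_continuous R)).
apply: measurable_sum => i; apply: measurable_funX; exact: measurable_tnth.
Qed.

Definition damped_sin2 (R : realType) (n : nat) (t : R)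
    (xi : n.-tuple (measurableTypeR R)) : R :=
  (1 + euclidean_norm xi ^+ 2) `^ (- t)
  * sin (t * Num.sqrt (ln (1 + euclidean_norm xi ^+ 2))) ^+ 2.

Lemma damped_sin2_ge0 (R : realType) (n : nat) (t : R) xi : 0 <= @damped_sin2 R n t xi.
Proof. by rewrite mulr_ge0 ?powR_ge0 ?sqr_ge0. Qed.

Lemma measurable_damped_sin2 (R : realType) (n : nat) (t : R) :
  measurable_fun setT (@damped_sin2 R n t).
Proof.
have m1 : measurable_fun setT
    (fun xi : n.-tuple (measurableTypeR R) => 1 + euclidean_norm xi ^+ 2).
  apply: measurable_funD => //; apply: measurable_funX; exact: measurable_euclidean_norm.
apply: measurable_funM.
  by apply: (measurableT_comp (measurable_powR (- t))).
apply: measurable_funX; apply: measurableT_comp.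
  exact: (continuous_measurable_fun (@continuous_sin R)).
apply: measurable_funM => //; apply: measurableT_comp.
  exact: (continuous_measurable_fun (@sqrt_continuous R)).
by apply: measurableT_comp => //; exact: measurable_ln.
Qed.

(** Reduces a lower bound in [n.+1] variables to one variable: by nonnegativity the domain may be
    shrunk to [I] times the box of the [A i], and every fibre over that box contributes at least
    [c]. *)
Lemma le_integral_fiber (R : realType) (n : nat) (I : set (measurableTypeR R))
    (A : 'I_n -> set (measurableTypeR R))
    (f : n.+1.-tuple (measurableTypeR R) -> \bar R) (c : R) :
  measurable I -> (forall i, measurable (A i)) ->
  measurable_fun setT f -> (forall x, 0 <= f x)%E -> 0 <= c ->
  (forall y, (forall i, A i (tnth y i)) ->
    (c%:E <= \int[lebesgue_measure]_(x in I) f (consp (x, y)))%E) ->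
  (c%:E * \prod_(i < n) lebesgue_measure (A i) <=
   \int[lebesgue_measure_tuple n.+1]_(x in [set: n.+1.-tuple (measurableTypeR R)]) f x)%E.
Proof.
move=> mI mA mf f0 c0 fc.
rewrite ge0_integral_lebesgue_measure_tupleS// -lebesgue_measure_tuple_box//.
set B := [set x | _].
have mB : measurable B.
  rewrite (_ : B = \bigcap_(i in [set: 'I_n])
      ((fun x : n.-tuple (measurableTypeR R) => tnth x i) @^-1` A i)); last first.
    by apply/seteqP; split => [x Ax i _|x Ax i]; [exact: Ax|exact: (Ax i)].
  apply: fin_bigcap_measurable => // i _.
  by rewrite -[X in measurable X]setTI; exact: measurable_tnth.
have mcf := measurableT_comp mf (@measurable_consp R n).
have mG := @measurable_fun_fubini_tonelli_G _ _ _ _ R lebesgue_measure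
  _ mcf (fun x => f0 (consp x)).
rewrite -integral_cst//.
apply: (@le_trans _ _ (\int[lebesgue_measure_tuple n]_(y in B)
    \int[lebesgue_measure]_x f (consp (x, y)))%E); last first.
  by apply: ge0_subset_integral => // y _; exact: integral_ge0.
apply: ge0_le_integral => //.
- exact: measurable_funTS mG.
- move=> y By; apply: le_trans (fc y By) _.
  apply: ge0_subset_integral => //.
  exact: measurableT_comp mcf (measurable_pair2 y).
Qed.

(** * The two bounds in arbitrary dimension *)

Lemma integral_damped_sin2_le (R : realType) (n : nat) (t : R) :
  (0 < n)%N -> n%:R <= t ->
  (\int[lebesgue_measure_tuple n]_(xi in [set: n.-tuple (measurableTypeR R)])
    (damped_sin2 R n t xi)%:E <= ((pi / Num.sqrt (t / n%:R)) ^+ n)%:E)%E.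
Proof.
move=> n0 nt.
have nR : 0 < n%:R :> R by rewrite ltr0n.
have s1 : 1 <= t / n%:R by rewrite ler_pdivlMr// mul1r.
(* This scale makes [(b * x) ^+ 2] equal to [t / n%:R * x ^+ 2], the term that Bernoulli's
   inequality produces. *)
set b := Num.sqrt _.
have b0 : 0 < b by rewrite sqrtr_gt0; lra.
pose g (x : R) := (1 + (b * x) ^+ 2)^-1.
have d0 x : 0 < 1 + (b * x) ^+ 2 by rewrite ltr_pwDl// sqr_ge0.
have g0 x : 0 <= g x by rewrite invr_ge0 ltW.
have mg : measurable_fun setT g.
  apply: continuous_measurable_fun => x; apply: cvgV; first by rewrite gt_eqF.
  apply: cvgD; first exact: cvg_cst.
  exact: (cvgM (@mulrl_continuous R b x) (@mulrl_continuous R b x)).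
rewrite -(@ge0_integral_prod_tuple R n g _ mg g0 (integral_oneDsqrM _ _ b0)).
apply: ge0_le_integral => //.
- by move=> x _; rewrite lee_fin damped_sin2_ge0.
- apply/measurable_EFinP; exact: measurable_damped_sin2.
- apply/measurable_EFinP; apply: measurable_prod => i _.
  by apply: measurableT_comp => //; exact: measurable_tnth.
move=> x _; rewrite lee_fin /damped_sin2.
set r := euclidean_norm x ^+ 2.
have r0 : 0 <= r by exact: sqr_ge0.
have le1 : sin (t * Num.sqrt (ln (1 + r))) ^+ 2 <= 1.
  by rewrite -[leRHS](cos2Dsin2 (t * Num.sqrt (ln (1 + r)))) lerDr sqr_ge0.
apply: (@le_trans _ _ ((1 + r) `^ (- t))).
  by rewrite -[leRHS]mulr1 ler_wpM2l// powR_ge0.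
rewrite powRN prodfV lef_pV2 ?posrE ?powR_gt0 ?prodr_gt0//; last by lra.
(* The exponent [t] is split into [n] equal parts [t / n%:R], each at least 1; the factor of index
   [i] keeps only the square of coordinate [i] from [r]. *)
apply: (@le_trans _ _ (\prod_(i < n) (1 + r) `^ (t / n%:R))); last first.
  by rewrite prodr_const card_ord -powR_mulrn ?powR_ge0// -powRrM divfK// gt_eqF.
apply: ler_prod => i _; rewrite ltW//=.
apply: le_trans (bernoulli_powR _ _ _ r0 s1).
rewrite lerD2l exprMn sqr_sqrtr; last by lra.
rewrite ler_wpM2l; [by []|lra|].
rewrite /r sqr_euclidean_norm (bigD1 i)//= lerDl sumr_ge0// => j _.
exact: sqr_ge0.
Qed.

Lemma integral_damped_sin2_ge (R : realType) (n : nat) (h : R) :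
  0 < h -> 8 * n.+1%:R * h <= 1 ->
  ((expR (- (4 * n.+1%:R)) / (32 * n.+1%:R) * h ^+ n.+1)%:E <=
   \int[lebesgue_measure_tuple n.+1]_(xi in [set: n.+1.-tuple (measurableTypeR R)])
    (damped_sin2 R n.+1 (h ^+ 2)^-1 xi)%:E)%E.
Proof.
move=> h0; set K : R := n.+1%:R => Kh.
have K1 : 1 <= K by rewrite ler1n.
have K0 : 0 < K by lra.
have hh : h <= 2 * h by lra.
have h20 : 0 < h ^+ 2 by rewrite exprn_gt0.
pose I : set (measurableTypeR R) := `[h, 2 * h]%classic.
have mI : measurable I by exact: measurable_itv.
have leI : lebesgue_measure I = h%:E.
  rewrite lebesgue_measure_itv/= lte_fin ifT; last by lra.
  by rewrite -EFinB; congr EFin; ring.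
(* The damping bound on the box times the one-variable bound; the other [n] sides of the box, of
   length [h] each, supply the missing power of [h]. *)
pose c := expR (- (4 * K)) * (h / (32 * K)).
have c0 : 0 <= c by rewrite mulr_ge0 ?expR_ge0// divr_ge0 ?mulr_ge0// ltW.
have -> : (expR (- (4 * K)) / (32 * K) * h ^+ n.+1)%:E =
    (c%:E * \prod_(i < n) lebesgue_measure ((fun=> I) i))%E.
  under eq_bigr do rewrite leI.
  rewrite prodEFin prodr_const card_ord -EFinM exprS; congr EFin.
  by rewrite /c; field; rewrite gt_eqF.
apply: (@le_integral_fiber R n I (fun=> I)) => //.
- apply/measurable_EFinP; exact: measurable_damped_sin2.
- by move=> x; rewrite lee_fin damped_sin2_ge0.
move=> y Iy; set q := euclidean_norm y ^+ 2.
have q0 : 0 <= q by exact: sqr_ge0.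
have qn : q <= n%:R * (4 * h ^+ 2).
  rewrite /q sqr_euclidean_norm mulr_natl -[n in leRHS]card_ord -sumr_const.
  apply: ler_sum => i _; have := Iy i; rewrite /I/= in_itv/= => /andP[? ?].
  nra.
(* Each of the [n] frozen coordinates and the free one contributes at most [4 * h ^+ 2], and [K] is
   [n + 1]. *)
have qK : 4 * h ^+ 2 + q <= 4 * K * h ^+ 2 by rewrite /K -natr1; lra.
have intI := ge_integral_sin2_sqrt_ln _ _ _ _ h0 K1 Kh q0 qK.
apply: (@le_trans _ _ ((expR (- (4 * K)))%:E * \int[lebesgue_measure]_(x in I)
    (sin ((h ^+ 2)^-1 * Num.sqrt (ln (1 + (x ^+ 2 + q)))) ^+ 2)%:E)%E).
  by rewrite EFinM lee_pmul2l ?fin_numE// lte_fin expR_gt0.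
have mS : measurable_fun I
    (fun x => (sin ((h ^+ 2)^-1 * Num.sqrt (ln (1 + (x ^+ 2 + q)))) ^+ 2)%:E).
  apply/measurable_EFinP; apply: measurable_funX; apply: measurableT_comp.
    exact: (continuous_measurable_fun (@continuous_sin R)).
  apply: measurable_funM => //; apply: measurableT_comp.
    exact: (continuous_measurable_fun (@sqrt_continuous R)).
  apply: measurableT_comp; first exact: measurable_ln.
  apply: measurable_funD => //; apply: measurable_funD => //.
rewrite -ge0_integralZl//; last first.
  by move=> x _; rewrite lee_fin sqr_ge0.
apply: ge0_le_integral => //.
- by move=> x _; rewrite -EFinM lee_fin mulr_ge0 ?expR_ge0 ?sqr_ge0.
- exact: measurable_funeM.
- apply/measurable_EFinP/measurable_funTS.
  exact: measurableT_comp (measurable_damped_sin2 R n.+1 _)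
    (measurableT_comp (@measurable_consp R n) (measurable_pair2 y)).
move=> x; rewrite /I/= in_itv/= => /andP[hx xh].
rewrite -EFinM lee_fin /damped_sin2 sqr_euclidean_norm_consp/=.
rewrite ler_wpM2r ?sqr_ge0// -/q.
have r0 : 0 < x ^+ 2 + q by rewrite ltr_wpDr// exprn_gt0//; lra.
have rK : x ^+ 2 + q <= 4 * K * h ^+ 2 by apply: le_trans qK; rewrite lerD2r; nra.
(* By [ln (1 + r) <= r <= 4 * K * h ^+ 2], the exponent [- ln (1 + r) / h ^+ 2] is at least
   [- (4 * K)]. *)
rewrite /powR gt_eqF; last by lra.
rewrite ler_expR mulNr lerN2 mulrC ler_pdivrMr//.
apply: le_trans rK; apply: le_ln1Dx; lra.
Qed.

(** * Assembling the bounds *)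

Theorem theorem4p1 (R : realType) (N : nat) (hN : (3 <= N)%N) :
  exists t0 C1 C2 : R, [/\ 0 < t0, 0 < C1, 0 < C2 &
    forall t : R, t0 <= t ->
      ((C1 * t `^ (- (N%:R / 2)))%:E
        <= \int[lebesgue_measure_tuple N]_(xi in [set: N.-tuple (measurableTypeR R)])
             ((1 + euclidean_norm xi ^+ 2) `^ (- t)
              * sin (t * Num.sqrt (ln (1 + euclidean_norm xi ^+ 2))) ^+ 2)%:E
        <= (C2 * t `^ (- (N%:R / 2)))%:E)%E].
Proof.
have N0 : (0 < N)%N by exact: leq_trans hN.
have N1 : 1 <= N%:R :> R by rewrite ler1n.
have NR : 0 < N%:R :> R by lra.
(* The threshold says exactly that [8 * N%:R * h <= 1] for [h = (Num.sqrt t)^-1], and it also gives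
   [N%:R <= t]. The second constant is what remains of [(pi / Num.sqrt (t / N%:R)) ^+ N] once
   [h ^+ N] is factored out. *)
exists ((8 * N%:R) ^+ 2), (expR (- (4 * N%:R)) / (32 * N%:R)), ((pi * Num.sqrt N%:R) ^+ N).
split.
- by rewrite exprn_gt0// mulr_gt0.
- by rewrite divr_gt0 ?expR_gt0// mulr_gt0.
- by rewrite exprn_gt0// mulr_gt0 ?pi_gt0// sqrtr_gt0.
move=> t t0.
have tN : N%:R <= t by apply: le_trans t0; nra.
have tp : 0 < t by lra.
pose h := (Num.sqrt t)^-1.
have st0 : 0 < Num.sqrt t by rewrite sqrtr_gt0.
have h0 : 0 < h by rewrite invr_gt0.
have tE : t = (h ^+ 2)^-1 by rewrite exprVn invrK sqr_sqrtr// ltW.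
have -> : t `^ (- (N%:R / 2)) = h ^+ N.
  rewrite powRN mulrC powRrM powR12_sqrt ?(ltW tp)//.
  by rewrite powR_mulrn ?exprVn// ltW.
apply/andP; split; last first.
  apply: le_trans (integral_damped_sin2_le _ _ _ N0 tN) _.
  rewrite lee_fin -exprMn sqrtrM ?(ltW tp)// sqrtrV ?(ltW NR)// invfM invrK.
  by rewrite le_eqVlt mulrAC mulrA eqxx.
rewrite [in X in (_ <= X)%E]tE.
case: N hN N0 N1 NR t0 tN => // n _ _ _ _ t0 _.
apply: integral_damped_sin2_ge => //.
rewrite ler_pdivrMr// mul1r -[leLHS]ger0_norm ?mulr_ge0// -sqrtr_sqr.
by rewrite ler_wsqrtr.
Qed.
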